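(* Let $n>1$ be an integer, let $A$ be an $n\times n$ consistent pairwise comparison matrix, and let $B\subseteq C_n$ be a set of generators of $A$ with exactly $n-1$ elements. Then: (1) if $h(B)=0$ then $n=2$; (2) $h(B)\neq 1$; (3) if $h(B)=2$ then $G_B$ is a path passing through all $n$ vertices (a Hamiltonian path of the vertex set $\{1,\dots,n\}$).
   Context: An $n\times n$ pairwise comparison (PC) matrix is a real matrix $A=[a_{ij}]$ with $a_{ij}>0$ for all $i,j$. It is consistent if $a_{ij}a_{jk}=a_{ik}$ for all $i,j,k\in\{1,\dots,n\}$. Let $C_n=\{(i,j):1\le i<j\le n\}$. A subset $B\subseteq C_n$ is a set of generators of a consistent PC matrix $A$ if every consistent $n\times n$ PC matrix $A'$ with $a'_{ij}=a_{ij}$ for all $(i,j)\in B$ equals $A$. For $B\subseteq C_n$, $G_B$ is the undirected simple graph on vertex set $\{1,\dots,n\}$ with edge $\{i,j\}$ ($i<j$) iff $(i,j)\in B$. For $i\in\{1,\dots,n\}$, the frequency $f(i,B)$ is the number of pairs $(j,k)\in B$ with $j=i$ or $k=i$ (equivalently the degree of $i$ in $G_B$). Let $O(B)=\{i: f(i,B)>0\}$. The total handicapping of $B$ is $h(B)=\sum_{i\in O(B)}\big(\max_{j\in O(B)} f(j,B) - f(i,B)\big)$. *)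

(* Defs.v *)
From mathcomp Require Import all_boot all_order all_algebra all_fingroup.
From mathcomp Require Import reals.

Set Implicit Arguments.
Unset Strict Implicit.
Unset Printing Implicit Defensive.

Import Order.TTheory GRing.Theory Num.Theory.

(* The vertex set {1, ..., n} is encoded as 'I_n = {0, ..., n-1}. *)

Definition pc_matrix (R : realType) (n : nat) (A : 'M[R]_n) : Prop :=
  forall i j : 'I_n, (0 < A i j)%R.

Definition consistent (R : realType) (n : nat) (A : 'M[R]_n) : Prop :=
  forall i j k : 'I_n, (A i j * A j k = A i k)%R.

Definition upper_pairs (n : nat) : {set 'I_n * 'I_n} :=
  [set p : 'I_n * 'I_n | p.1 < p.2].

Definition generators (R : realType) (n : nat) (B : {set 'I_n * 'I_n})
    (A : 'M[R]_n) : Prop :=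
  forall A' : 'M[R]_n, pc_matrix A' -> consistent A' ->
    (forall p, p \in B -> A' p.1 p.2 = A p.1 p.2) -> A' = A.

Definition graph_of (n : nat) (B : {set 'I_n * 'I_n}) : rel 'I_n :=
  fun i j => ((i, j) \in B) || ((j, i) \in B).

Definition freq (n : nat) (i : 'I_n) (B : {set 'I_n * 'I_n}) : nat :=
  #|[set p in B | (p.1 == i) || (p.2 == i)]|.

Definition occurring (n : nat) (B : {set 'I_n * 'I_n}) : {set 'I_n} :=
  [set i | 0 < freq i B].

(* Each term is a maximum minus one of the values it bounds, so the natural
   number subtraction is never truncated. *)
Definition handicapping (n : nat) (B : {set 'I_n * 'I_n}) : nat :=
  \sum_(i in occurring B) (\max_(j in occurring B) freq j B - freq i B).

(* The vertices can be enumerated as v 0, ..., v (n-1), without repetition, so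
   that the edges are exactly the pairs {v k, v (k+1)}: the whole graph, and
   not just a subgraph of it, is a path through all n vertices. *)
Definition is_spanning_path (n : nat) (e : rel 'I_n) : Prop :=
  exists v : 'S_n, forall k l : 'I_n,
    e (v k) (v l) = (k.+1 == l :> nat) || (l.+1 == k :> nat).

(* Main.v *)
(** Rescaling [A] by a diagonal matrix that is constant on each side of a cut
    which no pair of [B] crosses gives another consistent matrix agreeing with
    [A] on [B]; hence [G_B] is connected, and every vertex occurs in [B]. With
    [M] the maximal degree, [h(B) + 2 (n - 1) = n M], which settles (1) and (2)
    and gives [M = 2] in (3). The degree sum then leaves a vertex of degree one,
    and a path started there extends, by connectivity, until it meets all
    vertices: its non-final vertices have no further neighbours. *)
Require Import Defs.
From mathcomp Require Import all_boot all_order all_algebra all_fingroup.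
From mathcomp Require Import reals zify.

Set Implicit Arguments.
Unset Strict Implicit.
Unset Printing Implicit Defensive.

Import Order.TTheory GRing.Theory Num.Theory.

(** Connectivity by cuts rather than by walks: diagonal rescaling yields this form, and path
    extension consumes it. *)
Definition cut_connected (T : finType) (e : rel T) : Prop :=
  forall S : {set T}, S != set0 -> S != setT ->
    exists u w, [/\ u \in S, w \notin S & e u w].

Lemma uniq_leq_card (T : finType) (A : {set T}) (s : seq T) :
  uniq s -> {subset s <= A} -> size s <= #|A|.
Proof.
move=> us sA; rewrite -(card_uniqP us); apply: subset_leq_card.
by apply/subsetP => y /sA.
Qed.

(** The neighbours along the path already exhaust the degree bound: one at the start, two at an
    inner vertex. Hence [w] is one of them. *)
Lemma path_neighbor (T : finType) (e : rel T) (x : T) (p : seq T) k w :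
  symmetric e -> (forall u, #|[set y | e u y]| <= 2) ->
  #|[set y | e x y]| <= 1 ->
  path e x p -> uniq (x :: p) -> k < size p -> e (nth x (x :: p) k) w ->
  w = nth x (x :: p) k.+1 \/ 0 < k /\ w = nth x (x :: p) k.-1.
Proof.
move=> esym deg2 deg1 ep us kp ew.
have step i : i < size p -> e (nth x (x :: p) i) (nth x (x :: p) i.+1).
  by move/(pathP x): ep => /(_ i).
have [->|wk1] := eqVneq w (nth x (x :: p) k.+1); first by left.
right; case: k => [|k] in kp ew wk1 *.
  have: size [:: w; nth x (x :: p) 1] <= #|[set y | e x y]|.
    apply: uniq_leq_card; first by rewrite /= inE wk1.
    by move=> y; rewrite !inE => /orP [] /eqP -> //; exact: (step 0).
  by move/leq_trans/(_ deg1).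
split=> //; apply/eqP; apply: contraTT (deg2 (nth x (x :: p) k.+1)) => wk.
rewrite -ltnNge.
(* Otherwise [w], the predecessor and the successor are three distinct neighbours. *)
apply: (@uniq_leq_card _ _ [:: w; nth x (x :: p) k; nth x (x :: p) k.+2]).
  rewrite /= !inE negb_or wk wk1 /= andbT.
  by rewrite -[nth x p k.+1]/(nth x (x :: p) k.+2) nth_uniq //=; lia.
move=> y; rewrite !inE => /or3P [] /eqP -> //; last exact: step.
by rewrite esym; apply: step; lia.
Qed.

Lemma hamiltonian_path (T : finType) (e : rel T) (x : T) :
  symmetric e -> cut_connected e -> (forall u, #|[set y | e u y]| <= 2) ->
  #|[set y | e x y]| <= 1 ->
  exists p, [/\ path e x p, uniq (x :: p) & size (x :: p) = #|T|].
Proof.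
move=> esym conn deg2 deg1.
(* Induction on the number [k] of edges; [p] omits the start [x], so the path has [k.+1]
   vertices. *)
suff H k : k < #|T| ->
    exists p, [/\ path e x p, uniq (x :: p) & size p = k].
  have T0 : 0 < #|T| by apply/card_gt0P; exists x.
  have [|p [ep us sp]] := H #|T|.-1; first by rewrite prednK.
  by exists p; split=> //=; rewrite sp prednK.
elim: k => [|k IH] kT; first by exists [::].
have [p [ep us sp]] := IH (ltnW kT).
have [||u [w []]] := conn [set y in x :: p].
- by apply/set0Pn; exists x; rewrite !inE eqxx.
- apply: contraTneq kT => E; rewrite -leqNgt -cardsT -E cardsE.
  by rewrite (card_uniqP us) /= sp.
rewrite inE => uS; rewrite inE => wS euw.
have iu : index u (x :: p) < size (x :: p) by rewrite index_mem.
have nu : nth x (x :: p) (index u (x :: p)) = u by exact: nth_index.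
(* The edge from [u] to [w] leaves the visited set. If [u] is not the last vertex, [w] is already
   visited, a contradiction; otherwise [w] is appended. *)
have [ip|ip] := ltnP (index u (x :: p)) (size p).
  suff : w \in x :: p by rewrite (negPf wS).
  have [||] := @path_neighbor _ e x p (index u (x :: p)) w esym deg2 deg1
    ep us ip.
  - by rewrite nu.
  - by move->; apply: mem_nth.
  - by case=> _ ->; apply: mem_nth; apply: leq_ltn_trans (leq_pred _) iu.
exists (rcons p w); split; last by rewrite size_rcons sp.
- rewrite rcons_path ep (last_nth x).
  suff -> : size p = index u (x :: p) by rewrite nu.
  by apply/eqP; rewrite eqn_leq ip -ltnS.
- by rewrite -rcons_cons rcons_uniq wS.
Qed.

Lemma spanning_path_of_degrees (n : nat) (e : rel 'I_n) (x : 'I_n) :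
  symmetric e -> irreflexive e -> cut_connected e ->
  (forall u, #|[set y | e u y]| <= 2) -> #|[set y | e x y]| <= 1 ->
  is_spanning_path e.
Proof.
move=> esym eirr conn deg2 deg1.
have [p [ep us sz]] := hamiltonian_path esym conn deg2 deg1.
rewrite card_ord in sz.
have f_inj : injective (fun k : 'I_n => nth x (x :: p) k).
  move=> k l /eqP; rewrite nth_uniq ?sz // => /eqP; exact: val_inj.
(* The smaller index is never the last one, so [path_neighbor] applies to it; its predecessor case
   would force [l < k]. *)
have adj k l : k < l -> l < n ->
    e (nth x (x :: p) k) (nth x (x :: p) l) = (k.+1 == l).
  move=> kl ln; have kp : k < size p by move: sz => /=; lia.
  apply/idP/eqP => [/(path_neighbor esym deg2 deg1 ep us kp) H|<-].
    have k1 : k.-1 < n by lia.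
    have k2 : k.+1 < n by lia.
    case: H => [/eqP|[k0 /eqP]]; rewrite nth_uniq ?sz // => /eqP; lia.
  by move/(pathP x): ep => /(_ k kp).
exists (perm f_inj) => k l; rewrite !permE.
case: (ltngtP k l) => kl.
- rewrite adj //; lia.
- rewrite esym adj //; lia.
- by rewrite (val_inj kl) eirr; lia.
Qed.

Lemma graph_of_sym n (B : {set 'I_n * 'I_n}) : symmetric (graph_of B).
Proof. by move=> i j; rewrite /graph_of orbC. Qed.

Lemma graph_of_irr n (B : {set 'I_n * 'I_n}) :
  B \subset upper_pairs n -> irreflexive (graph_of B).
Proof.
move=> /subsetP BU i; rewrite /graph_of orbb; apply/negP => /BU.
by rewrite inE ltnn.
Qed.

(** A neighbour [j] is sent injectively to whichever of [(i, j)] and [(j, i)] lies in [B]. *)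
Lemma degree_leq_freq n (B : {set 'I_n * 'I_n}) (i : 'I_n) :
  #|[set j | graph_of B i j]| <= freq i B.
Proof.
pose f j := if (i, j) \in B then (i, j) else (j, i).
have f_inj : injective f.
  by move=> j k; rewrite /f; case: ifP; case: ifP => _ _ []; congruence.
rewrite -(card_imset _ f_inj); apply: subset_leq_card.
apply/subsetP => _ /imsetP [j] + ->.
rewrite !inE /graph_of /f; case: ifP => [-> _|_ /= ->] /=; by rewrite eqxx ?orbT.
Qed.

(** Double counting: each pair is counted at its two endpoints, which are distinct since
    [p.1 < p.2]. *)
Lemma sum_freq n (B : {set 'I_n * 'I_n}) :
  B \subset upper_pairs n -> \sum_i freq i B = 2 * #|B|.
Proof.
move=> /subsetP BU.
under eq_bigr => i _ do rewrite /freq -sum1dep_card big_mkcondr.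
rewrite exchange_big /= mulnC -sum_nat_const; apply: eq_bigr => p /BU.
rewrite inE => lt12; rewrite -big_mkcond /= sum1dep_card.
have -> : [set i | (p.1 == i) || (p.2 == i)] = [set p.1; p.2].
  by apply/setP => i; rewrite !inE ![i == _]eq_sym.
by rewrite cards2 neq_ltn lt12.
Qed.

Lemma generators_cut_connected (R : realType) n (A : 'M[R]_n)
    (B : {set 'I_n * 'I_n}) :
  pc_matrix A -> consistent A -> generators B A -> cut_connected (graph_of B).
Proof.
move=> Apos Acons gen S /set0Pn [i iS] ST.
have [j jS] : exists j, j \notin S.
  by apply/existsP; rewrite -negb_forall; apply: contra ST => /forallP H;
     apply/eqP/setP => k; rewrite H inE.
have [/existsP [u /existsP [w /and3P [uS wS uw]]]|none] :=
  boolP [exists u, exists w, [&& u \in S, w \notin S & graph_of B u w]].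
  by exists u, w.
have closed u w : u \in S -> graph_of B u w -> w \in S.
  move=> uS uw; apply: contraR none => wS.
  by apply/existsP; exists u; apply/existsP; exists w; rewrite uS wS.
(* No edge leaves [S], so scaling by 2 on [S] and by 1 elsewhere preserves every entry indexed by
   [B]. *)
pose d k : R := (if k \in S then 2 else 1)%R.
have d0 k : (0 < d k)%R by rewrite /d; case: ifP => _; rewrite ?ltr0n ?ltr01.
pose A' : 'M[R]_n := (\matrix_(k, l) (d k * A k l / d l))%R.
have E : A' = A.
  apply: gen => [k l|k l m|[k l] /= klB]; rewrite !mxE.
  - by rewrite divr_gt0 ?mulr_gt0.
  - rewrite -(Acons k l m) !mulrA; congr (_ * _ * _)%R.
    by rewrite mulfVK ?gt_eqF.
  - have -> : d l = d k.
      rewrite /d; suff -> : (l \in S) = (k \in S) by [].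
      by apply/idP/idP => H; apply: closed H _; rewrite /graph_of klB ?orbT.
    by rewrite mulrAC divff ?mul1r ?gt_eqF.
(* Across the cut the equality reads [2 * A i j = A i j], against [0 < A i j]. *)
have := congr1 (fun M : 'M[R]_n => M i j) E.
rewrite mxE /d iS (negPf jS) divr1 => /eqP.
by rewrite -[eqbRHS]mul1r (inj_eq (mulIf _)) gt_eqF ?ltr1n.
Qed.

(** The cut around [[set i]], proper because [1 < n], is crossed by an edge at [i]. *)
Lemma freq_gt0 n (B : {set 'I_n * 'I_n}) (i : 'I_n) :
  1 < n -> cut_connected (graph_of B) -> 0 < freq i B.
Proof.
move=> n1 conn; apply: leq_trans (degree_leq_freq B i); apply/card_gt0P.
have [||u [w []]] := conn [set i].
- by apply/set0Pn; exists i; rewrite inE.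
- by apply: contraTneq n1 => E; rewrite -[n]card_ord -cardsT -E cards1.
by rewrite inE => /eqP -> _ iw; exists w; rewrite inE.
Qed.

(** Every vertex occurs, so adding the degree sum [2 * #|B|] turns each summand into the maximal
    degree. *)
Lemma handicapping_connected n (B : {set 'I_n * 'I_n}) :
  1 < n -> B \subset upper_pairs n -> cut_connected (graph_of B) ->
  handicapping B + 2 * #|B| = n * \max_j freq j B.
Proof.
move=> n1 BU conn; rewrite /handicapping -(sum_freq BU).
have -> : occurring B = setT by apply/setP => i; rewrite !inE freq_gt0.
under [X in X + _]eq_bigl => i do rewrite inE.
under eq_bigr => i _ do under eq_bigl => j do rewrite inE.
rewrite -big_split /= -[X in X * _](card_ord n) -sum_nat_const.
by apply: eq_bigr => i _; rewrite subnK // (leq_bigmax (F := fun j => freq j B)).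
Qed.

Theorem mainTheorem5 (R : realType) (n : nat) (A : 'M[R]_n)
    (B : {set 'I_n * 'I_n}) :
  1 < n ->
  pc_matrix A -> consistent A ->
  B \subset upper_pairs n -> generators B A ->
  #|B| = n - 1 ->
  [/\ handicapping B = 0 -> n = 2,
      handicapping B <> 1
    & handicapping B = 2 -> is_spanning_path (graph_of B)].
Proof.
move=> n1 Apos Acons BU gen cB.
have conn := generators_cut_connected Apos Acons gen.
have := handicapping_connected n1 BU conn.
rewrite cB; set M := \max_j freq j B => hM.
split; [move=> h0|move=> h1|move=> h2].
(* Over the integers [hM] says [n * (2 - M) = 2 - h], where [h] is the handicapping. For [h = 0]
   this leaves [M = 1] and [n = 2]; [h = 1] would force [n = 1]; [h = 2] gives [M = 2]. *)
- by case: M hM => [|[|M]]; nia.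
- by case: M hM => [|[|M]]; nia.
have M2 : M = 2 by nia.
have f2 u : freq u B <= 2 by rewrite -M2 (leq_bigmax (F := fun j => freq j B)).
have [x fx] : exists x, freq x B <= 1.
  apply/existsP; rewrite -[X in is_true X]negbK negb_exists.
  apply/negP => /forallP H.
  (* If all degrees were at least 2, their sum [2 * (n - 1)] would be at least [2 * n]. *)
  have : \sum_(i < n) 2 <= \sum_i freq i B.
    by apply: leq_sum => i _; rewrite ltnNge H.
  rewrite (sum_freq BU) cB sum_nat_const card_ord; lia.
apply: (spanning_path_of_degrees (x := x)) => //.
- exact: graph_of_sym.
- exact: graph_of_irr.
- by move=> u; apply: leq_trans (degree_leq_freq B u) (f2 u).
- exact: leq_trans (degree_leq_freq B x) fx.
Qed.
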